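(* Let $\mathbf{J}$ be a small dagger category. A dagger category $\mathbf{C}$ has a dagger limit for every dagger functor $\mathbf{J}\to\mathbf{C}$ if and only if the diagonal functor $\Delta\colon\mathbf{C}\to\mathbf{DagCat}(\mathbf{J},\mathbf{C})$ has a dagger adjoint $L$ (with $L$ right adjoint to $\Delta$) such that the counit $\Delta L\to\mathrm{id}$ is a partial isometry (i.e. all its components $L(D)\to D(A)$ are partial isometries).
   Context: A dagger category is a category $\mathbf{C}$ equipped with an identity-on-objects functor $\dagger\colon\mathbf{C}^{\mathrm{op}}\to\mathbf{C}$ satisfying $f^{\dagger\dagger}=f$. A dagger functor is a functor $F$ between dagger categories with $F(f^\dagger)=F(f)^\dagger$. A dagger adjunction is an adjunction between dagger categories in which both functors are dagger functors (so there is no distinction between left and right dagger adjoints). A morphism $f$ is a partial isometry if $f=ff^\dagger f$. $\mathbf{DagCat}(\mathbf{J},\mathbf{C})$ is the dagger category of dagger functors $\mathbf{J}\to\mathbf{C}$ and natural transformations, with dagger computed componentwise; $\Delta$ sends an object to the constant functor. A class $\Omega$ of objects of $\mathbf{J}$ is weakly initial if every object of $\mathbf{J}$ receives a morphism from some object in $\Omega$. A dagger limit of $(D,\Omega)$ is a limit $(L,l_A\colon L\to D(A))$ of $D$ such that $l_A$ is a partial isometry for all $A\in\Omega$ and $l_A^\dagger l_A l_B^\dagger l_B=l_B^\dagger l_B l_A^\dagger l_A$ for all $A,B\in\Omega$. A dagger limit of $D$ is a dagger limit of $(D,\Omega)$ for some weakly initial $\Omega$; when $D$ is a dagger functor this does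 not depend on the choice of weakly initial $\Omega$. *)

(* Defs.v *)
From Stdlib Require Import FunctionalExtensionality ProofIrrelevance.

Set Implicit Arguments.
Unset Strict Implicit.
Unset Printing Implicit Defensive.

Declare Scope dagger_scope.
Open Scope dagger_scope.

(* Objects and morphisms of every category live in one fixed universe, which is
   the size bound: "small" means small relative to this universe.  In
   particular functor categories are again categories in this sense. *)
Record category := Category {
  ob :> Type;
  hom : ob -> ob -> Type;
  idm : forall A : ob, hom A A;
  comp : forall A B C : ob, hom B C -> hom A B -> hom A C;
  comp_idl : forall (A B : ob) (f : hom A B), comp (idm B) f = f;
  comp_idr : forall (A B : ob) (f : hom A B), comp f (idm A) = f;
  comp_assoc : forall (A B C D : ob) (h : hom C D) (g : hom B C) (f : hom A B),
    comp h (comp g f) = comp (comp h g) f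
}.
Arguments hom {_} _ _.
Arguments idm {_} _.
Arguments comp {_ _ _ _} _ _.

Notation "g ∘ f" := (comp g f) (at level 40, left associativity) : dagger_scope.

Record functor (C D : category) := Functor {
  fob :> C -> D;
  fmap : forall A B : C, hom A B -> hom (fob A) (fob B);
  fmap_id : forall A : C, fmap (idm A) = idm (fob A);
  fmap_comp : forall (X Y Z : C) (g : hom Y Z) (f : hom X Y),
    fmap (g ∘ f) = fmap g ∘ fmap f
}.
Arguments fmap {_ _} _ {_ _} _.

Definition id_functor (C : category) : functor C C :=
  @Functor C C (fun A => A) (fun _ _ f => f)
    (fun _ => eq_refl) (fun _ _ _ _ _ => eq_refl).

Definition comp_functor (C D E : category)
  (G : functor D E) (F : functor C D) : functor C E.
Proof.
refine (@Functor C E (fun A => G (F A)) (fun _ _ f => fmap G (fmap F f)) _ _).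
- abstract (intros; rewrite !fmap_id; reflexivity).
- abstract (intros; rewrite !fmap_comp; reflexivity).
Defined.

Record nat_trans (C D : category) (F G : functor C D) := NatTrans {
  component :> forall A : C, hom (F A) (G A);
  naturality : forall (A B : C) (f : hom A B),
    component B ∘ fmap F f = fmap G f ∘ component A
}.

Lemma nat_trans_eq (C D : category) (F G : functor C D) (s t : nat_trans F G) :
  (forall A : C, s A = t A) -> s = t.
Proof.
destruct s as [s Hs], t as [t Ht]; cbn; intros E.
assert (E' : s = t) by (apply functional_extensionality_dep; exact E).
subst t; f_equal; apply proof_irrelevance.
Qed.

Definition id_nat (C D : category) (F : functor C D) : nat_trans F F.
Proof.
refine (@NatTrans C D F F (fun A => idm (F A)) _).
abstract (intros; rewrite comp_idl, comp_idr; reflexivity).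
Defined.

Definition comp_nat (C D : category) (F G H : functor C D)
  (t : nat_trans G H) (s : nat_trans F G) : nat_trans F H.
Proof.
refine (@NatTrans C D F H (fun A => t A ∘ s A) _).
abstract (intros; rewrite <- comp_assoc, naturality, comp_assoc, naturality,
            comp_assoc; reflexivity).
Defined.

Record adjunction (C D : category) (F : functor C D) (G : functor D C) :=
  Adjunction {
  unit : nat_trans (id_functor C) (comp_functor G F);
  counit : nat_trans (comp_functor F G) (id_functor D);
  triangle_left : forall A : C, counit (F A) ∘ fmap F (unit A) = idm (F A);
  triangle_right : forall B : D, fmap G (counit B) ∘ unit (G B) = idm (G B)
}.

Record cone (J C : category) (D : functor J C) := Cone {
  apex : C;
  leg : forall A : J, hom apex (D A);
  leg_natural : forall (A B : J) (f : hom A B), fmap D f ∘ leg A = leg B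
}.

Definition is_limit (J C : category) (D : functor J C) (K : cone D) : Prop :=
  forall K' : cone D,
    exists! m : hom (apex K') (apex K), forall A : J, leg K A ∘ m = leg K' A.

Definition weakly_initial (J : category) (Omega : J -> Prop) : Prop :=
  forall B : J, exists A : J, Omega A /\ inhabited (hom A B).

Record dagger_category := DaggerCategory {
  dcat :> category;
  dagger : forall A B : dcat, hom A B -> hom B A;
  dagger_id : forall A : dcat, dagger (idm A) = idm A;
  dagger_comp : forall (X Y Z : dcat) (g : hom Y Z) (f : hom X Y),
    dagger (g ∘ f) = dagger f ∘ dagger g;
  dagger_invol : forall (A B : dcat) (f : hom A B), dagger (dagger f) = f
}.
Arguments dagger {_ _ _} _.

Notation "f †" := (dagger f) (at level 1, format "f †") : dagger_scope.

Definition partial_isometry (C : dagger_category) (A B : C) (f : hom A B) : Prop :=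
  f = f ∘ f† ∘ f.

Record dagger_functor (C D : dagger_category) := DaggerFunctor {
  dfun :> functor C D;
  fmap_dagger : forall (A B : C) (f : hom A B), fmap dfun f† = (fmap dfun f)†
}.

Definition dagger_adjunction (C D : dagger_category)
  (F : dagger_functor C D) (G : dagger_functor D C) := adjunction F G.

Definition dagger_nat (J C : dagger_category) (F G : dagger_functor J C)
  (s : nat_trans F G) : nat_trans G F.
Proof.
refine (@NatTrans J C G F (fun A => (s A)†) _).
abstract (intros A B f;
  pose proof (f_equal (fun h => h†) (naturality s f†)) as E; cbn beta in E;
  rewrite !dagger_comp, !fmap_dagger, !dagger_invol in E; exact (eq_sym E)).
Defined.

Definition FunCat (J C : dagger_category) : category.
Proof.
refine (@Category (dagger_functor J C) (fun F G => nat_trans F G)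
  (fun F => id_nat F) (fun _ _ _ t s => comp_nat t s) _ _ _).
- abstract (intros; apply nat_trans_eq; intros; apply comp_idl).
- abstract (intros; apply nat_trans_eq; intros; apply comp_idr).
- abstract (intros; apply nat_trans_eq; intros; apply comp_assoc).
Defined.

Definition DagCat (J C : dagger_category) : dagger_category.
Proof.
refine (@DaggerCategory (FunCat J C)
  (fun (F G : dagger_functor J C) (s : nat_trans F G) => dagger_nat s) _ _ _).
- abstract (intros; apply nat_trans_eq; intros; apply dagger_id).
- abstract (intros; apply nat_trans_eq; intros; apply dagger_comp).
- abstract (intros; apply nat_trans_eq; intros; apply dagger_invol).
Defined.

Definition const_functor (J C : dagger_category) (X : C) : dagger_functor J C :=
  @DaggerFunctor J C
    (@Functor J C (fun _ => X) (fun _ _ _ => idm X) (fun _ => eq_refl)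
       (fun _ _ _ _ _ => eq_sym (comp_idl (idm X))))
    (fun _ _ _ => eq_sym (dagger_id X)).

Definition const_nat (J C : dagger_category) (X Y : C) (f : hom X Y) :
  nat_trans (const_functor J X) (const_functor J Y).
Proof.
refine (@NatTrans J C (const_functor J X) (const_functor J Y) (fun _ => f) _).
abstract (intros; exact (eq_trans (comp_idr f) (eq_sym (comp_idl f)))).
Defined.

Definition Delta_functor (J C : dagger_category) : functor C (DagCat J C).
Proof.
refine (@Functor C (DagCat J C) (fun X => const_functor J X)
  (fun X Y f => const_nat J f) _ _);
  abstract (intros; apply nat_trans_eq; reflexivity).
Defined.

Definition Delta (J C : dagger_category) : dagger_functor C (DagCat J C).
Proof.
refine (@DaggerFunctor C (DagCat J C) (Delta_functor J C) _).
abstract (intros; apply nat_trans_eq; reflexivity).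
Defined.

Definition is_dagger_limit_on (J : category) (C : dagger_category)
    (D : functor J C) (Omega : J -> Prop) (K : cone D) : Prop :=
  is_limit K /\
  (forall A : J, Omega A -> partial_isometry (leg K A)) /\
  (forall A B : J, Omega A -> Omega B ->
     (leg K A)† ∘ leg K A ∘ (leg K B)† ∘ leg K B =
     (leg K B)† ∘ leg K B ∘ (leg K A)† ∘ leg K A).

Definition is_dagger_limit (J : category) (C : dagger_category)
    (D : functor J C) (K : cone D) : Prop :=
  exists Omega : J -> Prop,
    weakly_initial Omega /\ is_dagger_limit_on Omega K.

(* A morphism of [DagCat J C] is a natural transformation, and the counit at
   [D] goes from the constant functor at [L D] to [D]. *)
Definition counit_at (J C : dagger_category) (L : dagger_functor (DagCat J C) C)
    (adj : dagger_adjunction (Delta J C) L) (D : dagger_functor J C) :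
    nat_trans (const_functor J (L D)) D :=
  counit adj D.

(* Main.v *)
Require Import Defs.
From Stdlib Require Import Classical ClassicalEpsilon.

Set Implicit Arguments.
Unset Strict Implicit.
Unset Printing Implicit Defensive.

(** Write l_A for the legs of a cone on D and consider the transition maps
    l_B l_A† : D(A) -> D(B).  Both directions of the theorem come down to the
    naturality of these maps in D: if L is the functor of chosen limits, with
    legs l on D and e on E, then for s : D -> E the equation L(s†) = L(s)†
    says, after composing with the legs, exactly that
    s_B l_B l_A† = e_B e_A† s_A.

    Since J is a dagger category, the relation between objects of having a
    morphism is an equivalence relation, and two natural transformations
    F -> G can be spliced: one is used on the class of a given object and the
    other elsewhere ([splice]).  Inside a class the supports l_A† l_A of the
    legs coincide, and all legs are partial isometries as soon as one in each
    class is.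

    From limits to the adjunction: chosen limits give a functor right adjoint
    to the diagonal in the usual way, and only preservation of the dagger
    needs an argument, namely the naturality of the transition maps
    ([transition_natural]).  For A and B in the same class it follows from
    naturality of the range projections l_A l_A†.  For A and B in different
    classes, commutation of the supports together with splicing shows that
    l_B l_A† behaves like a zero map: its composite with x_A is the same for
    every cone x on D with a given apex ([transition_constant]).  Comparing
    the two cones s l l_A† and e e_A† s_A on E with apex D(A) then yields the
    claim.

    From the adjunction to limits: the counit at D is a limit cone, and its
    components are partial isometries by assumption.  It remains to see that
    their supports commute.  Since L preserves daggers, the transition maps
    are natural ([counit_transition_natural]).  At the constant functor on X
    they are endomorphisms z_AB of X, and naturality against a splicing of the identity
    with an arbitrary g : X -> X gives z_AB g = z_AB when A and B lie in
    different classes.  As z_AB is also central, by naturality against constant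
    transformations, z_AB = z_AB z_BA = z_BA z_AB = z_BA.  Naturality
    against the counit itself turns the product of the supports at A and B
    into the support at A times z_AB, and this is self-adjoint because z_AB is
    central and z_AB† = z_BA = z_AB ([counit_supports_commute]). *)

(** * Splicing natural transformations along connected components *)

Section Splicing.
Variables (J : dagger_category) (C : category).

(** One morphism suffices for an equivalence relation, because morphisms of J
    can be reversed by the dagger. *)
Definition connected (A B : J) : Prop := inhabited (hom A B).

Lemma connected_refl (A : J) : connected A A.
Proof. exact (inhabits (idm A)). Qed.

Lemma connected_hom (A B B' : J) (f : hom B B') :
  connected A B <-> connected A B'.
Proof.
split; intros [g].
- exact (inhabits (f ∘ g)).
- exact (inhabits (f† ∘ g)).
Qed.

(** No naturality square relates objects of different classes, so the two
    halves need not be compatible. *)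
Definition splice (F G : functor J C) (A : J) (s t : nat_trans F G) :
  nat_trans F G.
Proof.
refine (@NatTrans J C F G
  (fun B => if excluded_middle_informative (connected A B) then s B else t B) _).
abstract (intros B B' f;
  pose proof (connected_hom A f) as E;
  destruct (excluded_middle_informative (connected A B));
  destruct (excluded_middle_informative (connected A B'));
  solve [tauto | apply naturality]).
Defined.

Lemma splice_in (F G : functor J C) (A B : J) (s t : nat_trans F G) :
  connected A B -> splice A s t B = s B.
Proof.
intros H; cbn; destruct (excluded_middle_informative (connected A B)); tauto.
Qed.

Lemma splice_out (F G : functor J C) (A B : J) (s t : nat_trans F G) :
  ~ connected A B -> splice A s t B = t B.
Proof.
intros H; cbn; destruct (excluded_middle_informative (connected A B)); tauto.
Qed.

End Splicing.

(** * Cones on dagger functors *)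

Section Cones.
Variables J C : dagger_category.

Definition cone_nat (D : dagger_functor J C) (K : cone D) :
  nat_trans (const_functor J (apex K)) D :=
  @NatTrans J C (const_functor J (apex K)) D (leg K)
    (fun A B f => eq_trans (comp_idr (leg K B)) (eq_sym (leg_natural K f))).

Definition nat_cone (D : dagger_functor J C) (X : C)
  (x : nat_trans (const_functor J X) D) : cone D :=
  @Cone J C D X x
    (fun A B f => eq_trans (eq_sym (naturality x f)) (comp_idr (x B))).

(** A morphism f : A -> B gives l_B = D(f) l_A and also l_A = D(f)† l_B, so
    that l_B† l_B = l_B† D(f) l_A = l_A† l_A. *)
Lemma leg_support_connected (D : dagger_functor J C) (K : cone D) (A B : J) :
  connected A B -> (leg K A)† ∘ leg K A = (leg K B)† ∘ leg K B.
Proof.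
intros [f].
rewrite <- (leg_natural K f) at 2.
rewrite comp_assoc; f_equal.
rewrite <- (leg_natural K f†), dagger_comp, fmap_dagger, dagger_invol.
reflexivity.
Qed.

(** Each object is connected to one of [Omega].  The conditions there transfer
    because they only involve supports, up to composing with some D(f). *)
Lemma dagger_limit_everywhere (D : dagger_functor J C) (K : cone D) :
  is_dagger_limit K -> is_dagger_limit_on (fun _ => True) K.
Proof.
intros [Omega [HW [HL [HP HC]]]]; split; [exact HL | split].
- intros B _. destruct (HW B) as [A [HA [f]]].
  unfold partial_isometry.
  rewrite <- comp_assoc, <- (leg_support_connected K (inhabits f)).
  rewrite <- (leg_natural K f) at 2.
  rewrite <- comp_assoc, (comp_assoc (leg K A)), <- (HP A HA).
  symmetry; apply leg_natural.
- intros B B' _ _.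
  destruct (HW B) as [A [HA f]], (HW B') as [A' [HA' f']].
  rewrite <- !(comp_assoc (_ ∘ _)).
  rewrite <- (leg_support_connected K f), <- (leg_support_connected K f').
  rewrite !comp_assoc; apply HC; assumption.
Qed.

Lemma limit_factor (D : dagger_functor J C) (K : cone D) (X : C)
    (x : nat_trans (const_functor J X) D) :
  is_limit K -> exists m : hom X (apex K), forall A, leg K A ∘ m = x A.
Proof.
intros HL; destruct (HL (nat_cone x)) as [m [Hm _]]; exists m; exact Hm.
Qed.

Lemma limit_jointly_monic (D : dagger_functor J C) (K : cone D) (X : C)
    (m n : hom X (apex K)) :
  is_limit K -> (forall A, leg K A ∘ m = leg K A ∘ n) -> m = n.
Proof.
intros HL E.
destruct (HL (nat_cone (comp_nat (cone_nat K) (const_nat J n)))) as [k [_ Hk]].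
rewrite <- (Hk m), <- (Hk n); [reflexivity | reflexivity | exact E].
Qed.

End Cones.

(** * Transition maps of dagger limits are natural *)

Section Forward.
Variables J C : dagger_category.

(** Replace l_B by l_B l_B† l_B and exchange the supports of l_A and l_B. *)
Lemma transition_absorbs (D : dagger_functor J C) (K : cone D) (A B : J) (X : C)
    (m : hom X (apex K)) :
  is_dagger_limit_on (fun _ => True) K ->
  leg K B ∘ (leg K A)† ∘ (leg K A ∘ m) =
  leg K B ∘ (leg K A)† ∘ leg K A ∘ (leg K B)† ∘ (leg K B ∘ m).
Proof.
intros [_ [HP HC]].
transitivity (leg K B ∘ (leg K B)† ∘ leg K B ∘ (leg K A)† ∘ leg K A ∘ m).
- rewrite <- (HP B I), !comp_assoc; reflexivity.
- pose proof (HC B A I I) as E.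
  apply (f_equal (fun h => leg K B ∘ h ∘ m)) in E.
  rewrite !comp_assoc in E; rewrite !comp_assoc; exact E.
Qed.

(** Apply [transition_absorbs] to the map induced by y and to the one induced
    by the splicing of x at A with y at B: both right-hand sides depend on the
    B-component only, which is y_B in either case. *)
Lemma transition_constant (D : dagger_functor J C) (K : cone D) (A B : J) (X : C)
    (x y : nat_trans (const_functor J X) D) :
  is_dagger_limit_on (fun _ => True) K -> ~ connected A B ->
  leg K B ∘ (leg K A)† ∘ x A = leg K B ∘ (leg K A)† ∘ y A.
Proof.
intros HK NC.
destruct (limit_factor (splice A x y) (proj1 HK)) as [m Hm].
destruct (limit_factor y (proj1 HK)) as [k Hk].
pose proof (transition_absorbs A B m HK) as E.
rewrite !Hm, splice_in, splice_out in E by (assumption || apply connected_refl).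
rewrite <- (Hk A), transition_absorbs, Hk by assumption.
exact E.
Qed.

Lemma transition_partial_isometry (D : dagger_functor J C) (K : cone D) (A B : J) :
  is_dagger_limit_on (fun _ => True) K ->
  partial_isometry (leg K B ∘ (leg K A)†).
Proof.
intros HK.
pose proof (transition_absorbs A B (leg K A)† HK) as E.
unfold partial_isometry.
rewrite !comp_assoc in E; rewrite dagger_comp, dagger_invol, !comp_assoc.
rewrite <- E.
pose proof (f_equal dagger (proj1 (proj2 HK) A I)) as E'.
rewrite !dagger_comp, !dagger_invol in E'.
rewrite <- !comp_assoc, <- E'; reflexivity.
Qed.

Section Cone_maps.
Variables (D E : dagger_functor J C) (K : cone D) (M : cone E).
Hypothesis HM : is_dagger_limit_on (fun _ => True) M.
Variable s : nat_trans D E.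

(** s l is a cone on E, hence factors through e, and e_A e_A† fixes whatever
    factors through e_A. *)
Lemma range_invariant (A : J) :
  leg M A ∘ (leg M A)† ∘ s A ∘ leg K A = s A ∘ leg K A.
Proof.
destruct (limit_factor (comp_nat s (cone_nat K)) (proj1 HM)) as [n Hn].
specialize (Hn A); cbn in Hn.
rewrite <- comp_assoc, <- Hn, comp_assoc, <- (proj1 (proj2 HM) A I).
reflexivity.
Qed.

(** Here [transition_constant] is applied to the cones s l l_A† and e e_A† s_A
    on E, both with apex D(A). *)
Lemma half_transition (A B : J) : ~ connected B A ->
  leg M A ∘ (leg M B)† ∘ s B ∘ leg K B ∘ (leg K A)† =
  leg M A ∘ (leg M B)† ∘ leg M B ∘ (leg M A)† ∘ s A.
Proof.
intros NC.
pose proof (transition_constant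
  (comp_nat s (comp_nat (cone_nat K) (const_nat J (leg K A)†)))
  (comp_nat (cone_nat M) (const_nat J ((leg M A)† ∘ s A))) HM NC) as H.
cbn in H; rewrite !comp_assoc in H; exact H.
Qed.

End Cone_maps.

Section Naturality.
Variables (D E : dagger_functor J C) (K : cone D) (M : cone E).
Hypothesis HK : is_dagger_limit_on (fun _ => True) K.
Hypothesis HM : is_dagger_limit_on (fun _ => True) M.
Variable s : nat_trans D E.

(** Both sides equal e_A e_A† s_A l_A l_A†, by [range_invariant] for s and by
    the dagger of [range_invariant] for s†. *)
Lemma range_projection_natural (A : J) :
  leg M A ∘ (leg M A)† ∘ s A = s A ∘ leg K A ∘ (leg K A)†.
Proof.
pose proof (f_equal dagger (range_invariant M HK (dagger_nat s) A)) as H.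
cbn in H; rewrite !dagger_comp, !dagger_invol in H.
rewrite <- comp_assoc, <- H, !comp_assoc.
rewrite (range_invariant K HM); reflexivity.
Qed.

(** With z = l_B l_A† and w = e_B e_A†, this is w† w s_A = s_A z† z.  Both
    sides equal w† s_B z, by [half_transition] for s and by the dagger of
    [half_transition] for s†. *)
Lemma transition_support_natural (A B : J) : ~ connected B A ->
  leg M A ∘ (leg M B)† ∘ leg M B ∘ (leg M A)† ∘ s A =
  s A ∘ leg K A ∘ (leg K B)† ∘ leg K B ∘ (leg K A)†.
Proof.
intros NC.
rewrite <- (half_transition K HM s NC).
pose proof (f_equal dagger (half_transition M HK (dagger_nat s) NC)) as H.
cbn in H; rewrite !dagger_comp, !dagger_invol, !comp_assoc in H.
exact H.
Qed.

(** In different classes, with z = l_B l_A† and w = e_B e_A†, one computes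
    s_B z = s_B z z† z = w w† s_B z = w w† w s_A = w s_A, using
    [transition_support_natural] at B and [half_transition] at A. *)
Lemma transition_natural (A B : J) :
  s B ∘ leg K B ∘ (leg K A)† = leg M B ∘ (leg M A)† ∘ s A.
Proof.
destruct (classic (connected A B)) as [[f] | NC].
- rewrite <- (leg_natural K f), <- (leg_natural M f), comp_assoc, naturality.
  pose proof (range_projection_natural A) as H.
  rewrite <- !comp_assoc in H; rewrite <- !comp_assoc, H; reflexivity.
- assert (NC' : ~ connected B A) by (intros [f]; exact (NC (inhabits f†))).
  pose proof (transition_partial_isometry A B HM) as HMz.
  pose proof (transition_partial_isometry A B HK) as HKz.
  unfold partial_isometry in HMz, HKz.
  rewrite HMz, <- (comp_assoc (s B)), HKz.
  rewrite !dagger_comp, !dagger_invol, !comp_assoc.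
  pose proof (half_transition K HM s NC') as H.
  pose proof (transition_support_natural NC) as H'.
  rewrite <- H'.
  apply (f_equal (fun h => leg M B ∘ (leg M A)† ∘ h)) in H.
  rewrite !comp_assoc in H; exact H.
Qed.

(** The map induced by s between the limits has as its dagger the map induced
    by s†: taking daggers, the conclusion reads n l_A† = e_A† s_A, which is
    tested by composing with each e_B. *)
Lemma dagger_limit_map (n : hom (apex K) (apex M)) :
  (forall A, leg M A ∘ n = s A ∘ leg K A) ->
  forall A, leg K A ∘ n† = (s A)† ∘ leg M A.
Proof.
intros Hn A.
assert (H : n ∘ (leg K A)† = (leg M A)† ∘ s A).
{ apply (limit_jointly_monic (proj1 HM)); intros B.
  rewrite !comp_assoc, Hn; apply transition_natural. }
apply (f_equal dagger) in H.
rewrite !dagger_comp, !dagger_invol in H; exact H.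
Qed.
End Naturality.

(** ** The limit functor and its adjunction *)

Variable lim : forall D : dagger_functor J C, cone D.
Hypothesis Hlim : forall D, is_dagger_limit_on (fun _ => True) (lim D).

Definition lift (D : dagger_functor J C) (X : C)
    (x : nat_trans (const_functor J X) D) : hom X (apex (lim D)) :=
  proj1_sig (constructive_indefinite_description _
    (limit_factor x (proj1 (Hlim D)))).

Lemma lift_leg (D : dagger_functor J C) (X : C)
    (x : nat_trans (const_functor J X) D) (A : J) :
  leg (lim D) A ∘ lift x = x A.
Proof.
exact (proj2_sig (constructive_indefinite_description _
    (limit_factor x (proj1 (Hlim D)))) A).
Qed.

Definition lim_functor : functor (DagCat J C) C.
Proof.
refine (@Functor (DagCat J C) C (fun D => apex (lim D))
  (fun D E (s : nat_trans D E) => lift (comp_nat s (cone_nat (lim D)))) _ _).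
- abstract (intros D; apply (limit_jointly_monic (proj1 (Hlim D))); intros A;
    rewrite lift_leg, comp_idr; apply comp_idl).
- abstract (intros D E F t s; apply (limit_jointly_monic (proj1 (Hlim F)));
    intros A; rewrite comp_assoc, !lift_leg; cbn;
    rewrite <- !comp_assoc, lift_leg; reflexivity).
Defined.

Definition lim_dagger_functor : dagger_functor (DagCat J C) C.
Proof.
refine (@DaggerFunctor (DagCat J C) C lim_functor _).
abstract (intros D E s; apply (limit_jointly_monic (proj1 (Hlim D))); intros A;
  cbn; rewrite lift_leg; symmetry;
  exact (dagger_limit_map (Hlim D) (Hlim E) (lift_leg (comp_nat s (cone_nat (lim D)))) A)).
Defined.

Definition lim_unit : nat_trans (id_functor C) (comp_functor lim_functor (Delta_functor J C)).
Proof.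
refine (@NatTrans C C (id_functor C) (comp_functor lim_functor (Delta_functor J C))
  (fun X => lift (id_nat (const_functor J X))) _).
abstract (intros X Y f;
  apply (limit_jointly_monic (proj1 (Hlim (const_functor J Y)))); intros A;
  etransitivity;
  [ etransitivity; [apply comp_assoc |
      exact (eq_trans (f_equal (fun h => h ∘ f)
               (lift_leg (id_nat (const_functor J Y)) A)) (comp_idl f))]
  | symmetry; etransitivity; [apply comp_assoc |
      etransitivity; [exact (f_equal (fun h => h ∘ _) (lift_leg _ A)) |
        etransitivity; [symmetry; apply comp_assoc |
          exact (eq_trans (f_equal (comp f)
                   (lift_leg (id_nat (const_functor J X)) A)) (comp_idr f))]]]]).
Defined.

Definition lim_counit :
  nat_trans (comp_functor (Delta_functor J C) lim_functor) (id_functor (DagCat J C)).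
Proof.
refine (@NatTrans (DagCat J C) (DagCat J C)
  (comp_functor (Delta_functor J C) lim_functor) (id_functor (DagCat J C))
  (fun D => cone_nat (lim D)) _).
abstract (intros D E s; apply nat_trans_eq; intros A; exact (lift_leg _ A)).
Defined.

Definition lim_adjunction : dagger_adjunction (Delta J C) lim_dagger_functor.
Proof.
refine (@Adjunction C (DagCat J C) (Delta J C) lim_dagger_functor lim_unit lim_counit _ _).
- intros X; apply nat_trans_eq; intros A; exact (lift_leg _ A).
- intros D; apply (limit_jointly_monic (proj1 (Hlim D))); intros A.
  etransitivity; [apply comp_assoc |].
  etransitivity; [exact (f_equal (fun h => h ∘ _) (lift_leg _ A)) |].
  etransitivity; [symmetry; apply comp_assoc |].
  exact (f_equal (comp (leg (lim D) A))
           (lift_leg (id_nat (const_functor J (apex (lim D)))) A)).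
Defined.
End Forward.

(** * The counit is a dagger limit cone *)

Section Backward.
Variables J C : dagger_category.
Variable L : dagger_functor (DagCat J C) C.
Variable adj : dagger_adjunction (Delta J C) L.

Lemma counit_natural (D E : dagger_functor J C) (s : nat_trans D E) (A : J) :
  counit_at adj E A ∘ fmap L (s : @hom (DagCat J C) D E) = s A ∘ counit_at adj D A.
Proof.
exact (f_equal (fun t : nat_trans _ _ => t A)
  (naturality (counit adj) (s : @hom (DagCat J C) D E))).
Qed.

Lemma counit_limit (D : dagger_functor J C) :
  is_limit (nat_cone (counit_at adj D)).
Proof.
intros K.
exists (fmap L (cone_nat K : @hom (DagCat J C) (const_functor J (apex K)) D)
        ∘ unit adj (apex K)).
split.
- intros A.
  etransitivity; [apply comp_assoc |].
  etransitivity; [exact (f_equal (fun h => h ∘ unit adj (apex K))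
                    (counit_natural (cone_nat K) A)) |].
  etransitivity; [symmetry; apply comp_assoc |].
  etransitivity; [| apply comp_idr].
  exact (f_equal (fun t : nat_trans (const_functor J (apex K)) (const_functor J (apex K)) =>
                    leg K A ∘ (t A : hom (apex K) (apex K)))
           (triangle_left adj (apex K))).
- intros m Hm.
  assert (E : cone_nat K = comp_nat (counit_at adj D) (const_nat J m))
    by (apply nat_trans_eq; intros A; symmetry; exact (Hm A)).
  rewrite E.
  change (comp_nat (counit_at adj D) (const_nat J m)) with
   ((counit adj D : @hom (DagCat J C) (const_functor J (L D)) D) ∘ fmap (Delta J C) m).
  rewrite fmap_comp, <- comp_assoc.
  pose proof (naturality (unit adj) m) as N; cbn in N |- *; rewrite <- N.
  rewrite comp_assoc.
  etransitivity; [exact (f_equal (fun h => h ∘ m) (triangle_right adj D)) | apply comp_idl].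
Qed.

Definition transition (D : dagger_functor J C) (A B : J) : hom (D B) (D A) :=
  counit_at adj D A ∘ (counit_at adj D B)†.

(** The naturality square of the counit at s, and the dagger of the one at s†,
    where L(s†) = L(s)†. *)
Lemma counit_transition_natural (D E : dagger_functor J C) (s : nat_trans D E) (A B : J) :
  s A ∘ transition D A B = transition E A B ∘ s B.
Proof.
unfold transition; rewrite comp_assoc, <- counit_natural, <- !comp_assoc; f_equal.
pose proof (f_equal dagger (counit_natural (dagger_nat s) B)) as H.
change (dagger_nat s : @hom (DagCat J C) E D) with
  ((s : @hom (DagCat J C) D E)†) in H.
rewrite fmap_dagger in H; cbn in H; rewrite !dagger_comp, !dagger_invol in H.
exact H.
Qed.

(** The transition map at a constant functor, typed over X itself so that it
    can be composed with arbitrary endomorphisms of X. *)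
Definition endo_transition (X : C) (A B : J) : hom X X :=
  transition (const_functor J X) A B.

Lemma endo_transition_central (X : C) (A B : J) (g : hom X X) :
  g ∘ endo_transition X A B = endo_transition X A B ∘ g.
Proof. exact (counit_transition_natural (const_nat J g) A B). Qed.

(** Naturality against the endotransformation of the constant functor that is
    the identity at A and g at B. *)
Lemma endo_transition_absorb (X : C) (A B : J) (g : hom X X) :
  ~ connected A B -> endo_transition X A B ∘ g = endo_transition X A B.
Proof.
intros NC.
pose proof (counit_transition_natural
  (splice A (id_nat (const_functor J X)) (const_nat J g)) A B) as H.
rewrite splice_in, splice_out in H by (assumption || apply connected_refl).
cbn in H; rewrite comp_idl in H; symmetry; exact H.
Qed.

(** Both sides equal their product in either order: each absorbs the other on
    the right, and they commute. *)
Lemma endo_transition_sym (X : C) (A B : J) :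
  ~ connected A B -> endo_transition X A B = endo_transition X B A.
Proof.
intros NC.
assert (NC' : ~ connected B A) by (intros [f]; exact (NC (inhabits f†))).
rewrite <- (endo_transition_absorb (endo_transition X B A) NC).
rewrite <- endo_transition_central.
exact (endo_transition_absorb (endo_transition X A B) NC').
Qed.

Lemma endo_transition_dagger (X : C) (A B : J) :
  (endo_transition X A B)† = endo_transition X B A.
Proof.
unfold endo_transition, transition.
rewrite dagger_comp, dagger_invol; reflexivity.
Qed.

(** Naturality of the transition maps against the counit itself, regarded as
    a transformation from the constant functor on L(D) to D. *)
Lemma counit_support_absorb (D : dagger_functor J C) (A B : J) :
  (counit_at adj D A)† ∘ counit_at adj D A ∘
    (counit_at adj D B)† ∘ counit_at adj D B =
  (counit_at adj D A)† ∘ counit_at adj D A ∘ endo_transition (L D) A B.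
Proof.
rewrite <- !comp_assoc; f_equal.
rewrite comp_assoc.
symmetry; exact (counit_transition_natural (counit_at adj D) A B).
Qed.

(** In different classes the product of the two supports is self-adjoint, by
    [counit_support_absorb]; in the same class the supports are equal. *)
Lemma counit_supports_commute (D : dagger_functor J C) (A B : J) :
  (counit_at adj D A)† ∘ counit_at adj D A ∘
    (counit_at adj D B)† ∘ counit_at adj D B =
  (counit_at adj D B)† ∘ counit_at adj D B ∘
    (counit_at adj D A)† ∘ counit_at adj D A.
Proof.
destruct (classic (connected A B)) as [Hc | NC].
- assert (H : (counit_at adj D A)† ∘ counit_at adj D A =
              (counit_at adj D B)† ∘ counit_at adj D B)
    by exact (leg_support_connected (nat_cone (counit_at adj D)) Hc).
  rewrite <- !(comp_assoc (_ ∘ _)).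
  exact (eq_trans (f_equal (comp _) (eq_sym H)) (f_equal (fun h => h ∘ _) H)).
- transitivity (((counit_at adj D A)† ∘ counit_at adj D A ∘
                  (counit_at adj D B)† ∘ counit_at adj D B)†).
  + rewrite counit_support_absorb.
    rewrite !dagger_comp, dagger_invol, endo_transition_dagger.
    rewrite <- (endo_transition_sym _ NC).
    exact (endo_transition_central A B
             ((counit_at adj D A)† ∘ counit_at adj D A)).
  + rewrite !dagger_comp, !dagger_invol, !comp_assoc; reflexivity.
Qed.
End Backward.

Theorem theorem6p3 (J C : dagger_category) :
  (forall D : dagger_functor J C, exists K : cone D, is_dagger_limit K) <->
  (exists (L : dagger_functor (DagCat J C) C)
          (adj : dagger_adjunction (Delta J C) L),
     forall (D : dagger_functor J C) (A : J),
       partial_isometry (counit_at adj D A)).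
Proof.
split.
- intros H.
  pose (lim := fun D => proj1_sig (constructive_indefinite_description _ (H D))).
  assert (Hlim : forall D, is_dagger_limit_on (fun _ => True) (lim D)).
  { intros D; apply dagger_limit_everywhere.
    exact (proj2_sig (constructive_indefinite_description _ (H D))). }
  exists (lim_dagger_functor Hlim), (lim_adjunction Hlim).
  intros D A; exact (proj1 (proj2 (Hlim D)) A I).
- intros [L [adj HP]] D.
  exists (nat_cone (counit_at adj D)), (fun _ => True); split.
  { intros B; exists B; split; [exact I | exact (connected_refl B)]. }
  split; [exact (counit_limit adj (D := D)) | split].
  + intros A _; exact (HP D A).
  + intros A B _ _; exact (counit_supports_commute adj D A B).
Qed.
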